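(* Let $\alpha,\beta>0$ and let $$\mathcal U=\bigl\{\mathbf u=(f,b,g,q)^\top\in\mathbb R^4:\ f>0,\ b\neq0,\ g>0,\ q>0,\ \alpha fb<\beta gq,\ 2\alpha fb+\beta gq>0\bigr\}.$$ Consider the system $\mathbf u_t+\mathbf F(\mathbf u)_x=0$ with $$\mathbf F(\mathbf u)=\Bigl(\tfrac{\alpha}{2}f^2b,\ \tfrac{\alpha}{2}fb^2,\ \alpha fgb+\tfrac{\beta}{2}g^2q,\ \tfrac{\beta}{2}gq^2+\alpha fbq\Bigr)^\top ,$$ and the change of variables $\mathbf V(\mathbf u)=(v_1,v_2,v_3,v_4)^\top$ with $v_1=b/f$, $v_2=fb$, $v_3=q/g$, $v_4=gq$. Then, for $\mathbf u\in\mathcal U$, the normalized right and left eigenvector matrices of the transformed Jacobian $\tilde{\mathbf A}=\dfrac{\partial\mathbf V}{\partial\mathbf u}\,\dfrac{\partial\mathbf F}{\partial\mathbf u}\,\dfrac{\partial\mathbf u}{\partial\mathbf V}$ are $$R=\begin{pmatrix}1&0&0&0\\0&1&0&0\\0&0&1&0\\0&\dfrac{4\alpha gq}{\alpha fb-3\beta gq}&0&1\end{pmatrix},\qquad L=\begin{pmatrix}1&0&0&0\\0&1&0&0\\0&0&1&0\\0&-\dfrac{4\alpha gq}{\alpha fb-3\beta gq}&0&1\end{pmatrix}.$$ That is, $L=R^{-1}$ and $$L\,\tilde{\mathbf A}\,R=\operatorname{diag}\Bigl(\tfrac{\alpha fb}{2},\ \tfrac{3\alpha fb}{2},\ \alpha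 fb+\tfrac{\beta gq}{2},\ \alpha fb+\tfrac{3\beta gq}{2}\Bigr).$$
   Context: The columns of a right eigenvector matrix are right eigenvectors, and the left eigenvector matrix is its inverse (its rows are left eigenvectors). ''Normalized'' refers to the freedom of rescaling each eigenvector. Here $\partial\mathbf V/\partial\mathbf u$ is the Jacobian matrix of the change of variables and $\partial\mathbf u/\partial\mathbf V$ is its inverse. *)

(* Defs.v *)
From HB Require Import structures.
From mathcomp Require Import all_boot all_order all_algebra.
From mathcomp Require Import all_classical all_reals all_analysis.

Set Implicit Arguments.
Unset Strict Implicit.
Unset Printing Implicit Defensive.

Import Order.TTheory GRing.Theory Num.Theory.
Import numFieldNormedType.Exports.

Local Open Scope classical_set_scope.
Local Open Scope ring_scope.

(* States u = (f, b, g, q) are row vectors, because the library's [jacobian]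
   is only defined between spaces of row vectors. *)
Definition uf (R : realType) (u : 'rV[R]_4) : R := u 0 0.
Definition ub (R : realType) (u : 'rV[R]_4) : R := u 0 1.
Definition ug (R : realType) (u : 'rV[R]_4) : R := u 0 2.
Definition uq (R : realType) (u : 'rV[R]_4) : R := u 0 3.

Definition state_domain (R : realType) (alpha beta : R) : set 'rV[R]_4 :=
  [set u | [/\ 0 < uf u, ub u != 0, 0 < ug u & 0 < uq u] /\
    alpha * uf u * ub u < beta * ug u * uq u /\
    0 < 2 * alpha * uf u * ub u + beta * ug u * uq u].

Definition flux (R : realType) (alpha beta : R) (u : 'rV[R]_4) : 'rV[R]_4 :=
  let f := uf u in let b := ub u in let g := ug u in let q := uq u in
  \row_(j < 4)
    [:: alpha / 2 * f ^+ 2 * b;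
        alpha / 2 * f * b ^+ 2;
        alpha * f * g * b + beta / 2 * g ^+ 2 * q;
        beta / 2 * g * q ^+ 2 + alpha * f * b * q]`_j.

Definition change_var (R : realType) (u : 'rV[R]_4) : 'rV[R]_4 :=
  let f := uf u in let b := ub u in let g := ug u in let q := uq u in
  \row_(j < 4) [:: b / f; f * b; q / g; g * q]`_j.

(* The library's [jacobian G u] acts on row vectors from the right, so its
   (i, j) entry is the i-th partial derivative of G_j. The transpose is the
   usual matrix dG/du, whose (i, j) entry is the j-th partial derivative
   of G_i. *)
Definition Jac (R : realType) (G : 'rV[R]_4 -> 'rV[R]_4) (u : 'rV[R]_4) :
  'M[R]_4 := (jacobian G u)^T.

Definition transformed_jacobian (R : realType) (alpha beta : R)
    (u : 'rV[R]_4) : 'M[R]_4 :=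
  Jac (@change_var R) u *m Jac (flux alpha beta) u
    *m invmx (Jac (@change_var R) u).

Definition right_eigenvector_matrix (R : realType) (n : nat)
    (A P : 'M[R]_n) : Prop :=
  P \in unitmx /\
  forall j : 'I_n, exists lambda : R, A *m col j P = lambda *: col j P.

Definition left_eigenvector_matrix (R : realType) (n : nat)
    (A P : 'M[R]_n) : Prop :=
  P \in unitmx /\
  forall i : 'I_n, exists lambda : R, row i P *m A = lambda *: row i P.

Definition Rmat (R : realType) (alpha beta : R) (u : 'rV[R]_4) : 'M[R]_4 :=
  let f := uf u in let b := ub u in let g := ug u in let q := uq u in
  let r := 4 * alpha * g * q / (alpha * f * b - 3 * beta * g * q) in
  \matrix_(i < 4, j < 4)
    (nth [::] [:: [:: 1; 0; 0; 0];
                  [:: 0; 1; 0; 0];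
                  [:: 0; 0; 1; 0];
                  [:: 0; r; 0; 1]] i)`_j.

Definition Lmat (R : realType) (alpha beta : R) (u : 'rV[R]_4) : 'M[R]_4 :=
  let f := uf u in let b := ub u in let g := ug u in let q := uq u in
  let r := 4 * alpha * g * q / (alpha * f * b - 3 * beta * g * q) in
  \matrix_(i < 4, j < 4)
    (nth [::] [:: [:: 1; 0; 0; 0];
                  [:: 0; 1; 0; 0];
                  [:: 0; 0; 1; 0];
                  [:: 0; - r; 0; 1]] i)`_j.

Definition char_speeds (R : realType) (alpha beta : R) (u : 'rV[R]_4) :
    'rV[R]_4 :=
  let f := uf u in let b := ub u in let g := ug u in let q := uq u in
  \row_(j < 4)
    [:: alpha * f * b / 2;
        3 * alpha * f * b / 2;
        alpha * f * b + beta * g * q / 2;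
        alpha * f * b + 3 * beta * g * q / 2]`_j.

(* Main.v *)
(** In the variables V the second and the fourth equation only couple through
    the term 2 alpha v4 (v2)_x, so the transformed Jacobian is lower triangular
    with a single off-diagonal entry; for the explicit triangular A this amounts
    to the identity dV/du * dF/du = A * dV/du. The eigenvectors are well defined because
    alpha f b < beta g q and beta g q > 0 force alpha f b - 3 beta g q < 0. *)
Require Import Defs.
From HB Require Import structures.
From mathcomp Require Import all_boot all_order all_algebra.
From mathcomp Require Import all_classical all_reals all_analysis.
From mathcomp Require Import ring lra.

Import Order.TTheory GRing.Theory Num.Theory.
Import numFieldNormedType.Exports.

Local Open Scope classical_set_scope.
Local Open Scope ring_scope.

(** * Differentials of maps between row vectors *)

(** A row is the sum of its coordinates times the constant basis rows [delta_mx 0 j], so sum and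
    scaling rules suffice. *)
Lemma is_diff_row {R : realType} {V : normedModType R} {n : nat}
    (h dh : 'I_n -> V -> R) (x : V) :
  (forall j, is_diff x (h j) (dh j)) ->
  is_diff x (fun y => \row_j h j y) (fun v => \row_j dh j v).
Proof.
move=> hd.
have row_sum (k : 'I_n -> V -> R) : (fun y => \row_j k j y) =
    \sum_(j < n) ((fun y => k j y *: delta_mx 0 j) : V -> 'rV[R]_n).
  apply/funext => y; rewrite fct_sumE [LHS]row_sum_delta.
  by apply: eq_bigr => j _; rewrite mxE.
rewrite !row_sum.
elim/big_ind2: _ => [||j _]; [exact: is_diff_cst | by move=> *; apply: is_diffD |].
have [hj djE] := hd j.
apply: DiffDef; first exact: differentiableZl.
by rewrite diffZl // djE.
Qed.

Lemma is_diff_coord {R : realType} {m n : nat} (i : 'I_m) (j : 'I_n)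
    (M : 'M[R]_(m, n)) :
  is_diff M (fun N : 'M[R]_(m, n) => N i j) (fun N => N i j).
Proof.
pose c (N : 'M[R]_(m, n)) := N i j.
have c_lin : linear c by move=> k A B; rewrite /c !mxE.
pose f : {linear 'M[R]_(m, n) -> R} :=
  HB.pack c (GRing.isLinear.Build _ _ _ _ c c_lin).
apply: DiffDef; first exact: differentiable_coord.
by rewrite (@diff_lin _ _ _ f) //; exact: coord_continuous.
Qed.

Lemma is_diff_inv {R : realType} {V : normedModType R} (h dh : V -> R) (x : V) :
  h x != 0 -> is_diff x h dh ->
  is_diff x (fun y => (h y)^-1) (- (h x) ^- 2 *: dh).
Proof.
move=> hx0 [hd dE]; apply: DiffDef; last by rewrite diffV // dE.
by apply: (@differentiable_comp _ _ _ _ h GRing.inv) => //; exact: differentiable_Rinv.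
Qed.

(** The differential is assembled from its coordinates by [is_diff_row], and the rows of [jacobian]
    are its values at the basis rows. The candidate appears as [M^T] because row vectors multiply
    from the left. *)
Lemma Jac_unique {R : realType} (G : 'rV[R]_4 -> 'rV[R]_4) (u : 'rV[R]_4)
    (M : 'M[R]_4) :
  (forall i, is_diff u (fun y => G y 0 i) (fun v => (v *m M^T) 0 i)) ->
  differentiable G u /\ Jac G u = M.
Proof.
move=> /is_diff_row /=.
have rowsE (k : 'rV[R]_4 -> 'rV[R]_4) : (fun y => \row_j k y 0 j) = k.
  by apply/funext => y; apply/rowP => j; rewrite mxE.
rewrite (rowsE G) (rowsE (fun v => v *m M^T)) => -[dG dE]; split => //.
apply: trmx_inj; rewrite /Jac trmxK /jacobian.
by apply/row_matrixP => i; rewrite !rowE mul_rV_lin1 /= dE.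
Qed.

Lemma forall_ord4 (P : 'I_4 -> Prop) :
  P 0 -> P 1 -> P 2 -> P 3 -> forall i, P i.
Proof.
move=> P0 P1 P2 P3 [[|[|[|[|//]]]] lti].
- by rewrite (_ : Ordinal lti = 0) //; exact: val_inj.
- by rewrite (_ : Ordinal lti = 1) //; exact: val_inj.
- by rewrite (_ : Ordinal lti = 2) //; exact: val_inj.
- by rewrite (_ : Ordinal lti = 3) //; exact: val_inj.
Qed.

Lemma sum_ord4 {V : nmodType} (F : 'I_4 -> V) :
  \sum_(i < 4) F i = F 0 + F 1 + F 2 + F 3.
Proof.
rewrite !big_ord_recr big_ord0 /= add0r.
by congr (F _ + F _ + F _ + F _); exact: val_inj.
Qed.

Definition mx4 {R : realType} (rows : seq (seq R)) : 'M[R]_4 :=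
  \matrix_(i < 4, j < 4) (nth [::] rows i)`_j.

(** Instance resolution computes [dh] from the algebraic shape of [h]; the two pointwise equalities
    then pass to the intended function and to the differential read off from a matrix. *)
Lemma is_diff_ext {R : realType} {V W : normedModType R} (h dh h' dh' : V -> W)
    (x : V) :
  is_diff x h dh -> h =1 h' -> dh =1 dh' -> is_diff x h' dh'.
Proof. by move=> hd /funext <- /funext <-. Qed.

Lemma scale_fctE {R : realType} {V : normedModType R} (k : R) (h : V -> R) (v : V) :
  (k *: h) v = k * h v.
Proof. by []. Qed.

Lemma row_mul_mx4 {R : realType} (v : 'rV[R]_4) (rows : seq (seq R)) (i : 'I_4) :
  (v *m (mx4 rows)^T) 0 i =
    let r := nth [::] rows i in
    r`_0 * uf v + r`_1 * ub v + r`_2 * ug v + r`_3 * uq v.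
Proof. by rewrite mxE sum_ord4 !mxE /= !(mulrC (v _ _)). Qed.

(** * Jacobians of the change of variables and of the flux *)

Section Jacobians.
Context {R : realType} (u : 'rV[R]_4).
Let f := uf u.
Let b := ub u.
Let g := ug u.
Let q := uq u.

Local Instance is_diff_uf : is_diff u (@uf R) (@uf R) := is_diff_coord _ _ _.
Local Instance is_diff_ub : is_diff u (@ub R) (@ub R) := is_diff_coord _ _ _.
Local Instance is_diff_ug : is_diff u (@ug R) (@ug R) := is_diff_coord _ _ _.
Local Instance is_diff_uq : is_diff u (@uq R) (@uq R) := is_diff_coord _ _ _.

Lemma Jac_change_var : f != 0 -> g != 0 ->
  differentiable (@change_var R) u /\
  Jac (@change_var R) u =
    mx4 [:: [:: - b / f ^+ 2; f^-1; 0; 0];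
            [:: b; f; 0; 0];
            [:: 0; 0; - q / g ^+ 2; g^-1];
            [:: 0; 0; q; g]].
Proof.
move=> f0 g0; apply: Jac_unique.
(* These two facts stay in the context so that instance resolution can differentiate the quotients
   [b / f] and [q / g] as products. *)
have dfV := is_diff_inv _ _ _ f0 is_diff_uf.
have dgV := is_diff_inv _ _ _ g0 is_diff_ug.
apply: forall_ord4.
- apply: (is_diff_ext (@ub R * (fun y => (uf y)^-1))) => v; first by rewrite mxE.
  by rewrite row_mul_mx4 /= !(addrfctE, mulrfctE) /= !scale_fctE -/f -/b; field.
- apply: (is_diff_ext (@uf R * @ub R)) => v; first by rewrite mxE.
  by rewrite row_mul_mx4 /= !(addrfctE, mulrfctE) /= !scale_fctE -/f -/b; ring.
- apply: (is_diff_ext (@uq R * (fun y => (ug y)^-1))) => v; first by rewrite mxE.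
  by rewrite row_mul_mx4 /= !(addrfctE, mulrfctE) /= !scale_fctE -/g -/q; field.
- apply: (is_diff_ext (@ug R * @uq R)) => v; first by rewrite mxE.
  by rewrite row_mul_mx4 /= !(addrfctE, mulrfctE) /= !scale_fctE -/g -/q; ring.
Qed.

Lemma Jac_flux (alpha beta : R) :
  differentiable (flux alpha beta) u /\
  Jac (flux alpha beta) u =
    mx4 [:: [:: alpha * f * b; alpha / 2 * f ^+ 2; 0; 0];
            [:: alpha / 2 * b ^+ 2; alpha * f * b; 0; 0];
            [:: alpha * g * b; alpha * f * g;
                alpha * f * b + beta * g * q; beta / 2 * g ^+ 2];
            [:: alpha * b * q; alpha * f * q;
                beta / 2 * q ^+ 2; beta * g * q + alpha * f * b]].
Proof.
apply: Jac_unique; apply: forall_ord4.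
(* Squares are spelled out as products, so the product rule alone yields the differential. *)
- apply: (is_diff_ext ((alpha / 2) *: (@uf R * @uf R * @ub R))) => v.
    by rewrite [RHS]mxE !(addrfctE, mulrfctE) /= ?scale_fctE; ring.
  by rewrite row_mul_mx4 /= !(addrfctE, mulrfctE) /= !scale_fctE -/f -/b; field.
- apply: (is_diff_ext ((alpha / 2) *: (@uf R * @ub R * @ub R))) => v.
    by rewrite [RHS]mxE !(addrfctE, mulrfctE) /= ?scale_fctE; ring.
  by rewrite row_mul_mx4 /= !(addrfctE, mulrfctE) /= !scale_fctE -/f -/b; field.
- eapply (is_diff_ext (alpha *: (@uf R * @ug R * @ub R) +
                       (beta / 2) *: (@ug R * @ug R * @uq R))) => [|v|v].
  + by eapply is_diffD; typeclasses eauto.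
  + by rewrite [RHS]mxE !(addrfctE, mulrfctE) /= ?scale_fctE; ring.
  + rewrite row_mul_mx4 /= !(addrfctE, mulrfctE) /= !scale_fctE -/f -/b -/g -/q.
    by field.
- eapply (is_diff_ext ((beta / 2) *: (@ug R * @uq R * @uq R) +
                       alpha *: (@uf R * @ub R * @uq R))) => [|v|v].
  + by eapply is_diffD; typeclasses eauto.
  + by rewrite [RHS]mxE !(addrfctE, mulrfctE) /= ?scale_fctE; ring.
  + rewrite row_mul_mx4 /= !(addrfctE, mulrfctE) /= !scale_fctE -/f -/b -/g -/q.
    by field.
Qed.

End Jacobians.

(** * The transformed Jacobian in explicit form *)

(** Indices are plain naturals: a case split makes them literals, and every [nth] computes. *)
Lemma mx4_mulP {R : realType} (r s t : seq (seq R)) :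
  (forall i j, (i < 4)%N -> (j < 4)%N ->
    let a := nth [::] r i in
    a`_0 * (nth [::] s 0)`_j + a`_1 * (nth [::] s 1)`_j +
    a`_2 * (nth [::] s 2)`_j + a`_3 * (nth [::] s 3)`_j = (nth [::] t i)`_j) ->
  mx4 r *m mx4 s = mx4 t.
Proof. by move=> rst; apply/matrixP => i j; rewrite !mxE sum_ord4 !mxE /= rst. Qed.

Lemma mx4_1 {R : realType} :
  1%:M = mx4 [:: [:: 1; 0; 0; 0]; [:: 0; 1; 0; 0];
                 [:: 0; 0; 1; 0]; [:: 0; 0; 0; 1]] :> 'M[R]_4.
Proof.
by apply/matrixP => -[[|[|[|[|//]]]] lti] [[|[|[|[|//]]]] ltj]; rewrite !mxE.
Qed.

(** The components f and b are both carried with velocity [alpha * f * b / 2], and g and q with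
    [alpha * f * b + beta * g * q / 2]. Hence the ratios v1 and v3 are purely transported, which
    explains the diagonal first and third rows. *)
Definition transformed_jacobian_rows {R : realType} (alpha beta : R)
    (u : 'rV[R]_4) : seq (seq R) :=
  let f := uf u in let b := ub u in let g := ug u in let q := uq u in
  [:: [:: alpha * f * b / 2; 0; 0; 0];
      [:: 0; 3 * alpha * f * b / 2; 0; 0];
      [:: 0; 0; alpha * f * b + beta * g * q / 2; 0];
      [:: 0; 2 * alpha * g * q; 0; alpha * f * b + 3 * beta * g * q / 2]].

Lemma Jac_change_var_unit {R : realType} (u : 'rV[R]_4) :
  uf u != 0 -> ub u != 0 -> ug u != 0 -> uq u != 0 ->
  Jac (@change_var R) u \in unitmx.
Proof.
move=> f0 b0 g0 q0; have [_ ->] := Jac_change_var u f0 g0.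
move: (uf u) (ub u) (ug u) (uq u) f0 b0 g0 q0 => f b g q f0 b0 g0 q0.
(* [W] is the Jacobian of the inverse change of variables, obtained by differentiating f^2 = v2/v1,
   b^2 = v1 v2, g^2 = v4/v3 and q^2 = v3 v4. *)
pose W := mx4 [:: [:: - f ^+ 2 / (2 * b); (2 * b)^-1; 0; 0];
                  [:: f / 2; (2 * f)^-1; 0; 0];
                  [:: 0; 0; - g ^+ 2 / (2 * q); (2 * q)^-1];
                  [:: 0; 0; g / 2; (2 * g)^-1]].
suff /mulmx1_unit[] : mx4 [:: [:: - b / f ^+ 2; f^-1; 0; 0]; [:: b; f; 0; 0];
  [:: 0; 0; - q / g ^+ 2; g^-1]; [:: 0; 0; q; g]] *m W = 1%:M by [].
rewrite mx4_1; apply: mx4_mulP => -[|[|[|[|//]]]] [|[|[|[|//]]]] _ _ /=.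
all: by field; rewrite ?f0 ?b0 ?g0 ?q0.
Qed.

Lemma transformed_jacobianE {R : realType} (alpha beta : R) (u : 'rV[R]_4) :
  uf u != 0 -> ub u != 0 -> ug u != 0 -> uq u != 0 ->
  transformed_jacobian alpha beta u = mx4 (transformed_jacobian_rows alpha beta u).
Proof.
move=> f0 b0 g0 q0; have JVu := Jac_change_var_unit u f0 b0 g0 q0.
rewrite /transformed_jacobian.
suff -> : Jac (@change_var R) u *m Jac (flux alpha beta) u =
    mx4 (transformed_jacobian_rows alpha beta u) *m Jac (@change_var R) u.
  by rewrite mulmxK.
have [_ ->] := Jac_change_var u f0 g0; have [_ ->] := Jac_flux u alpha beta.
rewrite /transformed_jacobian_rows.
move: (uf u) (ub u) (ug u) (uq u) f0 b0 g0 q0 => f b g q f0 b0 g0 q0.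
apply/matrixP => i j; rewrite !mxE !sum_ord4 !mxE.
case: i => [[|[|[|[|//]]]] /= _]; case: j => [[|[|[|[|//]]]] /= _].
all: by field; rewrite ?f0 ?b0 ?g0 ?q0.
Qed.

(** * Eigenvector matrices *)

(** Column by column, A P = P D says that P consists of right eigenvectors. Multiplying by Q = P^-1
    on both sides turns it into Q A = D Q, the same statement for the rows of Q. *)
Lemma eigenvector_matrices_diag {R : realType} (n : nat) (A P Q : 'M[R]_n)
    (d : 'rV[R]_n) :
  Q *m P = 1%:M -> A *m P = P *m diag_mx d ->
  [/\ right_eigenvector_matrix A P, left_eigenvector_matrix A Q,
      Q = invmx P & Q *m A *m P = diag_mx d].
Proof.
move=> QP AP; have [Qu Pu] := mulmx1_unit QP.
have QA : Q *m A = diag_mx d *m Q.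
  apply: (can_inj (mulmxK Pu)).
  by rewrite -mulmxA AP mulmxA QP mul1mx -mulmxA QP mulmx1.
split; last by rewrite QA -mulmxA QP mulmx1.
- split=> // j; exists (d 0 j).
  have -> : A *m col j P = col j (A *m P) by rewrite !colE mulmxA.
  by rewrite AP; apply/colP => i; rewrite mul_mx_diag !mxE mulrC.
- split=> // i; exists (d 0 i).
  by rewrite -row_mul QA; apply/rowP => j; rewrite mul_diag_mx !mxE.
- by apply: (can_inj (mulmxK Pu)); rewrite mulVmx.
Qed.

Theorem mainTheorem3 (R : realType) (alpha beta : R)
    (halpha : 0 < alpha) (hbeta : 0 < beta)
    (u : 'rV[R]_4) (hu : state_domain alpha beta u) :
  (* all the objects below are well defined at u *)
  [/\ differentiable (flux alpha beta) u,
      differentiable (@change_var R) u,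
      Jac (@change_var R) u \in unitmx
    & alpha * uf u * ub u - 3 * beta * ug u * uq u != 0] /\
  [/\ right_eigenvector_matrix (transformed_jacobian alpha beta u)
        (Rmat alpha beta u),
      left_eigenvector_matrix (transformed_jacobian alpha beta u)
        (Lmat alpha beta u),
      Lmat alpha beta u = invmx (Rmat alpha beta u)
    & Lmat alpha beta u *m transformed_jacobian alpha beta u
        *m Rmat alpha beta u
      = diag_mx (char_speeds alpha beta u)].
Proof.
case: hu => -[f_gt0 b0 g_gt0 q_gt0] [fb_lt_gq _].
have f0 := lt0r_neq0 f_gt0; have g0 := lt0r_neq0 g_gt0; have q0 := lt0r_neq0 q_gt0.
have den0 : alpha * uf u * ub u - 3 * beta * ug u * uq u != 0.
  have : 0 < beta * ug u * uq u by rewrite !mulr_gt0.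
  by move=> gq_gt0; apply: ltr0_neq0; lra.
have [dV _] := Jac_change_var u f0 g0; have [dF _] := Jac_flux u alpha beta.
split; first by split=> //; exact: Jac_change_var_unit.
rewrite transformed_jacobianE //; apply: eigenvector_matrices_diag.
- by rewrite mx4_1; apply: mx4_mulP => -[|[|[|[|//]]]] [|[|[|[|//]]]] _ _ /=; ring.
(* The only entry that is not immediate is the one in the last row and second column: 2 alpha g q +
   l4 r = r l2, with l2 and l4 the second and fourth speeds. Since l2 - l4 = (alpha f b - 3 beta g
   q)/2, this is what fixes r = 4 alpha g q / (alpha f b - 3 beta g q). *)
- apply/matrixP => i j; rewrite mul_mx_diag !mxE !sum_ord4 !mxE.
  by case: i => [[|[|[|[|//]]]] /= _]; case: j => [[|[|[|[|//]]]] /= _]; field.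
Qed.
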